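(* Let $\mathcal{S}=(\mathcal{X},\mathcal{U},\rightsquigarrow_F)$ be a transition system, where $F$ is a set-valued map assigning to each $(x,u)\in\mathcal{X}\times\mathcal{U}$ a nonempty set $F(x,u)$ and $\rightsquigarrow_F\ =\{(x,u,x')\in\mathcal{X}\times\mathcal{U}\times\mathcal{X}: x'\in F(x,u)\}$. Let $\widetilde{\mathcal{S}}=(\mathcal{X}_d,\mathcal{K},\rightsquigarrow_{\widetilde{F}})$ be a corresponding state-feedback abstraction of $\mathcal{S}$. Then $\mathcal{S}$ is an alternating simulation of $\widetilde{\mathcal{S}}$, that is, $\mathcal{S}\succcurlyeq_{\rm AS}\widetilde{\mathcal{S}}$.
   Context: A transition system is a tuple $(\mathcal{X},\mathcal{U},\rightsquigarrow)$ with state set $\mathcal{X}$, input set $\mathcal{U}$ and transition set $\rightsquigarrow\ \subseteq\mathcal{X}\times\mathcal{U}\times\mathcal{X}$; write $x\overset{u}{\rightsquigarrow}x'$ for $(x,u,x')\in\ \rightsquigarrow$. Define $\mathrm{Post}(x,\rightsquigarrow,u)=\{x'\in\mathcal{X}: x\overset{u}{\rightsquigarrow}x'\}$ and $\mathrm{Available}(x,\rightsquigarrow)=\{u\in\mathcal{U}:\exists x'\in\mathcal{X},\ x\overset{u}{\rightsquigarrow}x'\}$. State-feedback abstraction. Let $\mathcal{S}=(\mathcal{X},\mathcal{U},\rightsquigarrow_F)$ be as in the claim, and let $\widetilde{\mathcal{S}}=(\mathcal{X}_d,\mathcal{K},\rightsquigarrow_{\widetilde{F}})$ be a transition system where $\mathcal{X}_d$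 is a set of cells $\xi\subset\mathcal{X}$ and $\mathcal{K}$ is a set of memoryless state-feedback controllers $\kappa:\mathcal{X}\to\mathcal{U}$. Then $\widetilde{\mathcal{S}}$ is a state-feedback abstraction of $\mathcal{S}$ if and only if $\xi\overset{\kappa}{\rightsquigarrow}_{\widetilde{F}}\xi'$ implies that for all $x\in\xi$ we have $F(x,\kappa(x))\subset\xi'$. Alternating simulation. Given transition systems $\mathcal{S}_1=(\mathcal{X}_1,\mathcal{U}_1,\rightsquigarrow_1)$, $\mathcal{S}_2=(\mathcal{X}_2,\mathcal{U}_2,\rightsquigarrow_2)$ and a relation $R\subseteq\mathcal{X}_1\times\mathcal{X}_2$, the extended relation $R^e$ is the set of $(x_1,x_2,u_1,u_2)$ such that for every $x_2'\in\mathrm{Post}(x_2,\rightsquigarrow_2,u_2)$ there exists $x_1'\in\mathrm{Post}(x_1,\rightsquigarrow_1,u_1)$ with $(x_1',x_2')\in R$. If for all $(x_1,x_2)\in R$ and all $u_1\in\mathrm{Available}(x_1,\rightsquigarrow_1)$ there exists $u_2\in\mathrm{Available}(x_2,\rightsquigarrow_2)$ with $(x_1,x_2,u_1,u_2)\in R^e$, then $R$ is an alternating simulation relation, $R^e$ is its associated extended alternating simulation relation, and $\mathcal{S}_2$ is an alternating simulation of $\mathcal{S}_1$, written $\mathcal{S}_2\succcurlyeq_{\rm AS}\mathcal{S}_1$. *)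

(* Defs.v *)
From mathcomp Require Import all_boot.
From mathcomp Require Import boolp classical_sets functions.

Set Implicit Arguments.
Unset Strict Implicit.
Unset Printing Implicit Defensive.

Local Open Scope classical_set_scope.

Record transition_system := TransitionSystem {
  state : Type;
  input : Type;
  trans : state -> input -> state -> Prop }.

Arguments trans : clear implicits.

Definition Post (S : transition_system) (x : state S) (u : input S) :
    set (state S) :=
  [set x' | trans S x u x'].

Definition Available (S : transition_system) (x : state S) : set (input S) :=
  [set u | exists x', trans S x u x'].

Definition extended_relation (S1 S2 : transition_system)
    (R : state S1 -> state S2 -> Prop) (x1 : state S1) (x2 : state S2)
    (u1 : input S1) (u2 : input S2) : Prop :=
  forall x2', Post x2 u2 x2' -> exists2 x1', Post x1 u1 x1' & R x1' x2'.

Definition alternating_simulation_relation (S1 S2 : transition_system)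
    (R : state S1 -> state S2 -> Prop) : Prop :=
  forall x1 x2, R x1 x2 ->
  forall u1, Available x1 u1 ->
  exists2 u2, Available x2 u2 & extended_relation R x1 x2 u1 u2.

(* [S2] is an alternating simulation of [S1].  No initial states occur, so the
   empty relation is always a witness; a meaningful assertion has to name the
   relation, as [alternating_simulation_relation] does. *)
Definition alternating_simulation_of (S2 S1 : transition_system) : Prop :=
  exists R : state S1 -> state S2 -> Prop, alternating_simulation_relation R.

(* The state set [X] is a subset of an ambient type [E], and [F] takes values
   in subsets of [E]: successors outside [X] are allowed, and are dropped from
   the transition set. *)
Definition map_system (E U : Type) (X : set E) (F : X -> U -> set E) :
    transition_system :=
  @TransitionSystem X U (fun x u x' => F x u (set_val x')).

(* A cell is a [set X], so its inclusion in the state set holds by typing. *)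
Definition state_feedback_system (E U : Type) (X : set E)
    (Xd : set (set X)) (K : set (X -> U)) (T : Xd -> K -> Xd -> Prop) :
    transition_system :=
  @TransitionSystem Xd K T.

Definition state_feedback_abstraction (E U : Type) (X : set E)
    (F : X -> U -> set E) (Xd : set (set X)) (K : set (X -> U))
    (T : Xd -> K -> Xd -> Prop) : Prop :=
  forall (xi : Xd) (kappa : K) (xi' : Xd), T xi kappa xi' ->
  forall x : X, set_val xi x ->
    F x (set_val kappa x) `<=` set_val @` set_val xi'.

Definition cell_membership (E : Type) (X : set E) (Xd : set (set X))
    (xi : Xd) (x : X) : Prop := set_val xi x.

(* Main.v *)
(* At a state [x] of a cell [xi] the controller [kappa] is matched by the input
   [kappa x]; the cell reached under [kappa] contains every successor of [x]. *)
Require Import Defs.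
From mathcomp Require Import all_boot.
From mathcomp Require Import boolp classical_sets functions.

Set Implicit Arguments.
Unset Strict Implicit.
Unset Printing Implicit Defensive.

Local Open Scope classical_set_scope.

(** Membership of a state in a cell is the simulation relation. One target cell [xi'] answers all
    successors of [x] at once, since the abstraction property puts all of [F x (kappa x)] inside
    it. *)

Theorem lemma1 (E U : Type) (X : set E) (F : X -> U -> set E)
    (F_nonempty : forall (x : X) (u : U), F x u !=set0)
    (Xd : set (set X)) (K : set (X -> U)) (T : Xd -> K -> Xd -> Prop)
    (F_abstraction : state_feedback_abstraction F T) :
  alternating_simulation_of (map_system F) (state_feedback_system T) /\
  @alternating_simulation_relation (state_feedback_system T) (map_system F)
    (@cell_membership E X Xd).
Proof.
suff sim : @alternating_simulation_relation (state_feedback_system T)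
    (map_system F) (@cell_membership E X Xd).
  by split=> //; exists (@cell_membership E X Xd).
move=> xi x xi_x kappa [xi' Txi'].
have succ_cell := F_abstraction xi kappa xi' Txi' x xi_x.
exists (set_val kappa x).
  (* [y] is only known to lie in [E]; [succ_cell] places it in a cell, hence in [X], so it gives a
     genuine transition. *)
  have [y Fy] := F_nonempty x (set_val kappa x).
  by have [x' _ x'y] := succ_cell y Fy; exists x'; rewrite /= x'y.
move=> x' Fx'; exists xi' => //.
(* The inclusion holds in [E]; injectivity of [set_val] brings it back to [X]. *)
by have [x'' xi'_x'' /val_inj <-] := succ_cell _ Fx'.
Qed.
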